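(* Let $\nu>-\frac{1}{2}$ and let $n\geq 1$ be an integer. Then, for all $x\geq 0$, $$\left|I_{(\nu,0,n)}(x)\,\frac{K_{\nu+n}(x)}{x^{\nu}}\right|\leq\frac{2^{n-1}}{2\nu+1}.$$
   Context: Here $\nu$ is real, and $I_\nu$ and $K_\nu$ denote the modified Bessel functions of the first and second kind, respectively, of order $\nu$. The function $I_{(\nu,0,n)}$ is the $n$-fold repeated integral of $x^\nu I_\nu(x)$, defined recursively by $$I_{(\nu,0,0)}(x)=x^{\nu}I_{\nu}(x),\qquad I_{(\nu,0,n+1)}(x)=\int_0^x I_{(\nu,0,n)}(y)\,dy,\quad n=0,1,2,\ldots.$$ At $x=0$ the expression is understood as its limit as $x\downarrow 0$. *)

(* Defs.v *)
From HB Require Import structures.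
From mathcomp Require Import all_boot all_order all_algebra.
From mathcomp Require Import all_classical all_reals all_analysis.

Set Implicit Arguments.
Unset Strict Implicit.
Unset Printing Implicit Defensive.

Import Order.TTheory GRing.Theory Num.Theory.
Import numFieldNormedType.Exports.

Local Open Scope classical_set_scope.
Local Open Scope ring_scope.

Section bessel.
Context {R : realType}.

(* The integral diverges (and [Rintegral] is then a junk value) for [s <= 0];
   it is only used below at positive arguments. *)
Definition euler_integral (s : R) : R :=
  \int[lebesgue_measure]_(t in `]0, +oo[) (t `^ (s - 1) * expR (- t)).

Definition gamma_shift (s : R) : nat :=
  if 0 < s then 0%N else (Num.truncn (- s)).+1.

(* The entire function 1/Gamma on the whole real line, through
   Gamma(s + m) = s (s + 1) ... (s + m - 1) Gamma(s), where m is such that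
   s + m > 0. It is the inverse of [euler_integral s] when [0 < s], and it
   vanishes at the poles 0, -1, -2, ... of Gamma. *)
Definition rgamma (s : R) : R :=
  (\prod_(i < gamma_shift s) (s + i%:R)) /
  euler_integral (s + (gamma_shift s)%:R).

(* I_nu(x) = sum_k (x/2)^(nu + 2k) / (k! Gamma(nu + k + 1)), for x > 0. *)
Definition besselI (nu x : R) : R :=
  limn (series (fun k : nat =>
    (x / 2) `^ (nu + (k.*2)%:R) * rgamma (nu + k%:R + 1) / (k`!)%:R)).

Definition cosh (t : R) : R := (expR t + expR (- t)) / 2.

(* K_nu(x) = int_0^oo exp(- x cosh t) cosh(nu t) dt, for x > 0 and any real
   order nu, the integer orders included. *)
Definition besselK (nu x : R) : R :=
  \int[lebesgue_measure]_(t in `[0, +oo[) (expR (- (x * cosh t)) * cosh (nu * t)).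

(* I_(nu,0,n). For -1/2 < nu < 0 the base case may be unbounded near 0; the
   integrals are Lebesgue integrals, insensitive to its value at 0. *)
Fixpoint besselI_int (nu : R) (n : nat) (x : R) : R :=
  match n with
  | 0%N => x `^ nu * besselI nu x
  | m.+1 => \int[lebesgue_measure]_(y in `[0, x]) besselI_int nu m y
  end.

Definition besselIK_pos (nu : R) (n : nat) (x : R) : R :=
  besselI_int nu n x * (besselK (nu + n%:R) x / x `^ nu).

(* At 0 the formula for [besselIK_pos] is meaningless (K is singular there). *)
Definition besselIK (nu : R) (n : nat) (x : R) : R :=
  if x == 0 then lim (besselIK_pos nu n y @[y --> 0^'+])
  else besselIK_pos nu n x.

End bessel.

(* Main.v *)
Require Import Defs.
From HB Require Import structures.
From mathcomp Require Import all_boot all_order all_algebra.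
From mathcomp Require Import all_classical all_reals all_analysis.
From mathcomp Require Import measurable_realfun ring lra.
Import Order.TTheory GRing.Theory Num.Theory.
Import numFieldNormedType.Exports.
Local Open Scope classical_set_scope.
Local Open Scope ring_scope.

(** Put y = x^2/4, G_p(y) = int_0^oo s^(p-1) exp(-s - y/s) ds (so that
    G_p(0) = Gamma(p)) and B_p(y) = sum_k y^k / (k! Gamma(p+k)). Then
    K_p(x) = G_p(y) / (2 (x/2)^p) and I_p(x) = (x/2)^p B_(p+1)(y), and, writing
    I_(nu,0,n) as a series integrated termwise, the coefficients compare with
    those of B_(nu+n+1):
      I_(nu,0,n)(x) K_(nu+n)(x) / x^nu
        <= 2^(n-1) (nu+n)/(2nu+1) B_(nu+n+1)(y) G_(nu+n)(y).
    It remains to see that p B_(p+1) G_p <= 1. As p G_p <= G_(p+1), it suffices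
    that B_p G_p <= 1, which holds because the Wronskian-like quantity
    B_p G_p + y B_(p+1) G_(p-1) is invariant under p -> p + 1, by the three-term
    recurrences of B and G, and is bounded by a quantity that tends to 1 as
    p -> oo. The limit at 0 exists because both factors are monotone in x. *)

Set Implicit Arguments.
Unset Strict Implicit.
Unset Printing Implicit Defensive.

(** * Integration by exhaustion *)

Section exhaustion.
Context {R : realType}.
Implicit Types (f F : R -> R) (a b : nat -> R) (D : set R).
Notation mu := (@lebesgue_measure R).

Lemma continuous_in_within f (A : set R) :
  (forall s, A s -> {for s, continuous f}) -> {within A, continuous f}.
Proof.
by move=> cf; apply: continuous_in_subspaceT => s; rewrite inE; exact: cf.
Qed.

(** Monotone convergence along an increasing sequence of segments; continuity is used only for
    measurability on each of them. *)
Lemma cvg_integral_exhaust f a b D :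
  nonincreasing_seq a -> nondecreasing_seq b ->
  D = \bigcup_m `[a m, b m]%classic ->
  (forall s, D s -> {for s, continuous f}) -> (forall s, D s -> 0 <= f s) ->
  (\int[mu]_(s in `[a m, b m]) (f s)%:E)%E @[m --> \oo] -->
  (\int[mu]_(s in D) (f s)%:E)%E.
Proof.
move=> nia ndb -> cf f0; apply: ge0_nondecreasing_set_cvg_integral => //.
- move=> m n mn; rewrite subsetEset => s /=; rewrite !in_itv/= => /andP[h1 h2].
  by rewrite (le_trans (nia _ _ mn) h1) (le_trans h2 (ndb _ _ mn)).
- move=> m; apply/measurable_EFinP; apply: subspace_continuous_measurable_fun => //.
  by apply: continuous_in_within => s sm; apply: cf; exists m.
- by move=> m s sm; rewrite lee_fin f0//; exists m.
Qed.

Lemma is_derive1_continuous F (s d : R) : is_derive s 1 F d -> {for s, continuous F}.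
Proof.
by move=> h; apply: differentiable_continuous; apply/derivable1_diffP; apply: ex_derive.
Qed.

(** The fundamental theorem of calculus on each segment, followed by a passage to the limit.
    Splitting the derivative into nonnegative [f1] and [f2] and writing the identity additively in
    the extended reals keeps it meaningful when the integrals over [D] are infinite. *)
Lemma integral_exhaust_FTC f1 f2 F a b D (l0 l : R) :
  nonincreasing_seq a -> nondecreasing_seq b -> (forall m, a m < b m) ->
  D = \bigcup_m `[a m, b m]%classic ->
  (forall s, D s -> {for s, continuous f1}) -> (forall s, D s -> 0 <= f1 s) ->
  (forall s, D s -> {for s, continuous f2}) -> (forall s, D s -> 0 <= f2 s) ->
  (forall s, D s -> is_derive s 1 F (f1 s - f2 s)) ->
  F (a m) @[m --> \oo] --> l0 -> F (b m) @[m --> \oo] --> l ->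
  (\int[mu]_(s in D) (f1 s)%:E + l0%:E = \int[mu]_(s in D) (f2 s)%:E + l%:E)%E.
Proof.
move=> nia ndb ab DE c1 p1 c2 p2 dF Fa Fb.
have sub m s : `[a m, b m]%classic s -> D s by rewrite DE => h; exists m.
have cvg1 := cvg_integral_exhaust nia ndb DE c1 p1.
have cvg2 := cvg_integral_exhaust nia ndb DE c2 p2.
have cF m s : a m <= s <= b m -> {for s, continuous F}.
  move=> h; apply: is_derive1_continuous; apply: dF.
  by apply: (sub m); rewrite /= in_itv.
have int_f f m : (forall s, D s -> {for s, continuous f}) ->
    mu.-integrable `[a m, b m]%classic (EFin \o f).
  move=> cf; apply: continuous_compact_integrable; first exact: segment_compact.
  by apply: continuous_in_within => s /sub; exact: cf.
have step m : (\int[mu]_(s in `[a m, b m]) (f1 s)%:E + (F (a m))%:E =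
    \int[mu]_(s in `[a m, b m]) (f2 s)%:E + (F (b m))%:E)%E.
  have := @continuous_FTC2 _ (fun s => f1 s - f2 s) F (a m) (b m) (ab m).
  have amb := ltW (ab m).
  have i1 := int_f f1 m c1; have i2 := int_f f2 m c2.
  under eq_integral do rewrite EFinB.
  rewrite integralB//.
  have n1 : (\int[mu]_(s in `[a m, b m]) (f1 s)%:E)%E \is a fin_num.
    exact: integrable_fin_num.
  have n2 : (\int[mu]_(s in `[a m, b m]) (f2 s)%:E)%E \is a fin_num.
    exact: integrable_fin_num.
  (* On a segment both integrals are finite, so the identity can be rearranged among real
     numbers. *)
  rewrite -(fineK n1) -(fineK n2) => H.
  have {}H : (fine (\int[mu]_(s in `[a m, b m]) (f1 s)%:E) -
    fine (\int[mu]_(s in `[a m, b m]) (f2 s)%:E))%:E = (F (b m) - F (a m))%:E.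
    apply: H.
    - by apply: continuous_in_within => s /sub sD; apply: cvgB; [exact: c1|exact: c2].
    - split.
      + move=> s; rewrite in_itv/= => /andP[h1 h2]; apply: ex_derive.
        by apply: dF; apply: (sub m); rewrite /= in_itv/= !ltW.
      + by apply: cvg_at_right_filter; apply: (cF m); rewrite lexx.
      + by apply: cvg_at_left_filter; apply: (cF m); rewrite lexx andbT.
    - move=> s; rewrite in_itv/= => /andP[h1 h2]; rewrite derive1E.
      by apply: derive_val; apply: dF; apply: (sub m); rewrite /= in_itv/= !ltW.
  by case: H => H; rewrite -!EFinD; congr EFin; lra.
have L1 : ((\int[mu]_(s in `[a m, b m]) (f1 s)%:E + (F (a m))%:E)%E) @[m --> \oo] -->
    (\int[mu]_(s in D) (f1 s)%:E + l0%:E)%E.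
  by apply: cvgeD => //; [rewrite fin_num_adde_defl|apply: cvg_EFin => //; exact: nearW].
have L2 : ((\int[mu]_(s in `[a m, b m]) (f2 s)%:E + (F (b m))%:E)%E) @[m --> \oo] -->
    (\int[mu]_(s in D) (f2 s)%:E + l%:E)%E.
  by apply: cvgeD => //; [rewrite fin_num_adde_defl|apply: cvg_EFin => //; exact: nearW].
rewrite (_ : (fun m => _) = (fun m => (\int[mu]_(s in `[a m, b m]) (f2 s)%:E + (F (b m))%:E)%E)) in L1; last first.
  by apply/funext => m; exact: step.
exact: cvg_unique L1 L2.
Qed.

(** Starting at 2 rather than 1 makes every segment nondegenerate, as the strict inequality
    [a m < b m] of [integral_exhaust_FTC] demands. *)
Lemma itv_oy_bigcup : `]0, +oo[%classic = \bigcup_m `[(m.+2%:R : R)^-1, m.+2%:R]%classic.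
Proof.
apply/seteqP; split => [s|s [m _]] /=; rewrite !in_itv/= ?andbT; last first.
  by move=> /andP[+ _]; apply: lt_le_trans; rewrite invr_gt0.
(* The sum of the two truncations makes m + 2 exceed both s and 1/s. *)
move=> s0; exists (Num.truncn s + Num.truncn s^-1)%N => //=; rewrite in_itv/=; apply/andP; split.
  rewrite invf_ple ?posrE//; apply/ltW/(lt_le_trans (truncnS_gt _)).
  by rewrite ler_nat ltnS leqW// (leq_addr, leq_addl).
apply/ltW/(lt_le_trans (truncnS_gt _)).
by rewrite ler_nat ltnS leqW// (leq_addr, leq_addl).
Qed.

Lemma itv_oc_bigcup (x : R) : 0 < x ->
  `]0, x]%classic = \bigcup_m `[x * (m.+2%:R)^-1, x]%classic.
Proof.
move=> x0.
apply/seteqP; split => [s|s [m _]] /=; rewrite !in_itv/=; last first.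
  by move=> /andP[h ->]; rewrite andbT (lt_le_trans _ h)// mulr_gt0// invr_gt0.
move=> /andP[s0 sx]; exists (Num.truncn (x / s))%N => //=; rewrite in_itv/= sx andbT.
rewrite ler_pdivrMr// mulrC -ler_pdivrMr//.
by apply/ltW/(lt_le_trans (truncnS_gt _)); rewrite ler_nat.
Qed.

End exhaustion.

(** * The integral G_p(y) *)

Section gamma_kernel.
Context {R : realType}.
Implicit Types (p y s : R).
Notation mu := (@lebesgue_measure R).

(** The exponent is [p], so G_p has integrand [gker (p - 1) y]. Thus [gker p y] is both the
    integrand of G_(p+1) and the primitive that produces the recurrence of G. *)
Definition gker p y s : R := s `^ p * expR (- (s + y / s)).

Lemma gker_ge0 p y s : 0 <= gker p y s.
Proof. by rewrite mulr_ge0 ?powR_ge0 ?expR_ge0. Qed.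

Lemma gker_le p y z s : y <= z -> 0 < s -> gker p z s <= gker p y s.
Proof.
move=> yz s0; rewrite ler_wpM2l ?powR_ge0// ler_expR lerN2 lerD2l.
by rewrite ler_wpM2r// invr_ge0 ltW.
Qed.

Lemma gker0 p s : gker p 0 s = s `^ p * expR (- s).
Proof. by rewrite /gker mul0r addr0. Qed.

Lemma powRB1 p s : 0 < s -> s `^ (p - 1) = s `^ p / s.
Proof.
move=> s0; rewrite powRB; last by rewrite (gt_eqF s0) implybT.
by rewrite powRr1// ltW.
Qed.

Lemma is_derive_gker p y s : 0 < s ->
  is_derive s 1 (gker p y) (p * gker (p - 1) y s + y * gker (p - 2) y s - gker p y s).
Proof.
move=> s0; have sn0 : s != 0 by rewrite gt_eqF.
have dV : is_derive s 1 (fun t : R => t^-1) (- s ^- 2 *: 1).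
  exact: (@is_deriveV R id).
have dP := is_derive1_powR p s0.
have dI := is_deriveN (is_deriveD (is_derive_id s (1 : R)) (is_deriveZ y dV)).
have dE := is_derive1_comp (is_derive_expR _) dI.
have := is_deriveM dP dE.
rewrite /gker => h; apply: (is_derive_eq h).
rewrite (_ : p - 2 = p - 1 - 1); last by ring.
rewrite !powRB1// /GRing.scale/= /GRing.scale/=.
have -> : (- (id \+ y \*: (fun t : R => t^-1)))%R s = - (s + y / s) by [].
by field.
Qed.

Lemma gker_continuous p y s : 0 < s -> {for s, continuous (gker p y)}.
Proof. by move=> /(is_derive_gker p y); exact: is_derive1_continuous. Qed.

Lemma measurable_gker p y : measurable_fun (`]0, +oo[%classic : set R) (gker p y).
Proof.
apply: open_continuous_measurable_fun; first exact: interval_open.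
by move=> s; rewrite inE/= in_itv/= andbT; exact: gker_continuous.
Qed.

Lemma cvg_inv_nat2 : (m.+2%:R : R)^-1 @[m --> \oo] --> (0 : R).
Proof. by have := @cvg_harmonic R; rewrite -cvg_shiftS. Qed.

Lemma gker_cvg0 p y : 0 < p -> 0 <= y ->
  gker p y (m.+2%:R)^-1 @[m --> \oo] --> 0.
Proof.
move=> p0 y0; apply: (@squeeze_cvgr _ _ _ _ (fun=> 0) (fun m => (m.+2%:R^-1) `^ p)).
- apply: nearW => m; rewrite gker_ge0/= ler_piMr ?powR_ge0// -expR0 ler_expR.
  by rewrite oppr_le0 addr_ge0// divr_ge0// invr_ge0.
- exact: cvg_cst.
- have /cvg_at_rightP := powR_cvg0 p0; apply; split => //.
  exact: cvg_inv_nat2.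
Qed.

(** With an integer N >= p, the exponential series gives exp(s) >= s^(N+1)/(N+1)!, so the kernel is
    at most (N+1)!/s for s >= 1. *)
Lemma gker_cvgy p y : 0 <= y -> gker p y m.+2%:R @[m --> \oo] --> 0.
Proof.
move=> y0; pose N := (Num.truncn p).+1.
apply: (@squeeze_cvgr _ _ _ _ (fun=> 0) (fun m => (N.+1)`!%:R * (m.+2%:R^-1))).
- apply: nearW => m; rewrite gker_ge0/=; set s : R := m.+2%:R.
  have s0 : 0 < s by rewrite ltr0n.
  apply: (le_trans (gker_le _ y0 s0)); rewrite gker0.
  apply: (@le_trans _ _ (s ^+ N * expR (- s))).
    rewrite ler_wpM2r ?expR_ge0// -powR_mulrn; last exact: ltW.
    by rewrite ler_powR ?ler1n//; exact/ltW/truncnS_gt.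
  rewrite expRN ler_pdivrMr ?expR_gt0//.
  have h : s ^+ N.+1 / N.+1`!%:R <= expR s.
    by apply: le_trans (expR_ge1Dxn N (ltW s0)); rewrite lerDr.
  have f0 : 0 < (N.+1)`!%:R / s :> R by rewrite divr_gt0// ltr0n fact_gt0.
  have := ler_wpM2l (ltW f0) h; apply: le_trans.
  rewrite exprS le_eqVlt; apply/orP; left; apply/eqP; field.
  by rewrite pnatr_eq0 -lt0n fact_gt0/= gt_eqF.
- exact: cvg_cst.
- rewrite -[X in _ --> X](mulr0 (N.+1)`!%:R); apply: cvgM; first exact: cvg_cst.
  exact: cvg_inv_nat2.
Qed.

(** Extended real values allow the recurrence to be proved first and finiteness to be deduced from
    it. *)
Definition egammaG p y : \bar R := (\int[mu]_(s in `]0%R, +oo[) (gker (p - 1) y s)%:E)%E.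

Lemma egammaG_ge0 p y : (0 <= egammaG p y)%E.
Proof. by apply: integral_ge0 => s _; rewrite lee_fin gker_ge0. Qed.

Lemma nonincreasing_invS2 : nonincreasing_seq (fun m => (m.+2%:R : R)^-1).
Proof. by move=> m n mn; rewrite lef_pV2 ?posrE// ler_nat ltnS. Qed.

Lemma nondecreasing_S2 : nondecreasing_seq (fun m => (m.+2%:R : R)).
Proof. by move=> m n mn; rewrite ler_nat ltnS. Qed.

Lemma invS2_lt (m : nat) : (m.+2%:R : R)^-1 < m.+2%:R.
Proof. by apply: (@lt_trans _ _ 1); rewrite ?invf_lt1 ?ltr1n. Qed.

(** Integrate the derivative of [gker p y] over the half-line; both boundary terms vanish. If y = 0
    and p <= 1, the last integral is infinite and the convention 0 * oo = 0 applies. *)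
Lemma egammaG_rec p y : 0 < p -> 0 <= y ->
  (egammaG (p + 1) y = p%:E * egammaG p y + y%:E * egammaG (p - 1) y)%E.
Proof.
move=> p0 y0.
have : (\int[mu]_(s in `]0%R, +oo[) (p * gker (p - 1) y s + y * gker (p - 2) y s)%:E
    + 0%:E = \int[mu]_(s in `]0%R, +oo[) (gker p y s)%:E + 0%:E)%E.
  apply: (integral_exhaust_FTC (F := gker p y) nonincreasing_invS2 nondecreasing_S2
    invS2_lt itv_oy_bigcup).
  - move=> s /=; rewrite in_itv/= andbT => s0.
    by apply: cvgD; apply: cvgMr; exact: gker_continuous.
  - by move=> s _; rewrite addr_ge0// mulr_ge0 ?gker_ge0// ltW.
  - by move=> s /=; rewrite in_itv/= andbT => s0; exact: gker_continuous.
  - by move=> s _; exact: gker_ge0.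
  - by move=> s /=; rewrite in_itv/= andbT => s0; exact: is_derive_gker.
  - exact: gker_cvg0.
  - exact: gker_cvgy.
rewrite !adde0 {1}/egammaG (_ : p + 1 - 1 = p); last by ring.
move=> <-.
rewrite /egammaG (_ : p - 1 - 1 = p - 2); last by ring.
rewrite -ge0_integralZl_EFin//; last 3 first.
- by move=> s _; rewrite lee_fin gker_ge0.
- by apply/measurable_EFinP; exact: measurable_gker.
- exact: ltW.
rewrite -ge0_integralZl_EFin//; last 2 first.
- by move=> s _; rewrite lee_fin gker_ge0.
- by apply/measurable_EFinP; exact: measurable_gker.
rewrite -ge0_integralD//.
- by move=> s _; rewrite lee_fin mulr_ge0 ?gker_ge0// ltW.
- by apply/measurable_EFinP; apply: measurable_funM => //; exact: measurable_gker.
- by move=> s _; rewrite lee_fin mulr_ge0 ?gker_ge0.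
- by apply/measurable_EFinP; apply: measurable_funM => //; exact: measurable_gker.
Qed.

Lemma egammaG_le p y z : y <= z -> (egammaG p z <= egammaG p y)%E.
Proof.
move=> yz; apply: ge0_le_integral => //.
- by move=> s _; rewrite lee_fin gker_ge0.
- by apply/measurable_EFinP; exact: measurable_gker.
- by apply/measurable_EFinP; exact: measurable_gker.
- by move=> s /=; rewrite in_itv/= andbT => s0; rewrite lee_fin gker_le.
Qed.

Lemma egammaG10 : egammaG 1 0 = 1%E.
Proof.
have dexp s : is_derive s 1 (fun t => expR (- t)) (- expR (- s)).
  have := is_derive1_comp (is_derive_expR _) (is_deriveNid s (1 : R)).
  by rewrite mulrN1.
rewrite /egammaG subrr; under eq_integral do rewrite gker0 powRr0 mul1r.
suff : (\int[mu]_(s in `]0%R, +oo[) (expR (- s))%:E + (- 1)%:E =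
    \int[mu]_(s in `]0%R, +oo[) 0%:E + 0%:E)%E.
  (* The equation I - 1 = 0 in the extended reals rules out infinite I. *)
  rewrite integral0 add0e; case: integral => [r||] //=.
  by rewrite -EFinD => -[/eqP]; rewrite subr_eq0 => /eqP ->.
apply: (integral_exhaust_FTC (F := fun s => - expR (- s)) nonincreasing_invS2
    nondecreasing_S2 invS2_lt itv_oy_bigcup).
- by move=> s _; exact: is_derive1_continuous.
- by move=> s _; rewrite expR_ge0.
- by move=> s _; exact: cvg_cst.
- by [].
- by move=> s _; rewrite subr0; have := is_deriveN (dexp s); rewrite opprK.
- have h : - (m.+2%:R : R)^-1 @[m --> \oo] --> (0 : R).
    by rewrite -oppr0; apply: cvgN; exact: cvg_inv_nat2.
  have := cvg_comp _ _ h (@continuous_expR R 0); rewrite expR0 => {}h.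
  exact: cvgN h.
- have := @gker_cvgy 0 0 (lexx _) => /cvgN; rewrite oppr0.
  by under eq_fun do rewrite gker0 powRr0 mul1r.
Qed.

(** Monotonicity reduces to y = 0, where integer orders follow from [egammaG10] and the recurrence,
    and real orders by comparison with integer ones. *)
Lemma egammaG_fin p y : 0 < p -> 0 <= y -> (egammaG p y < +oo)%E.
Proof.
move=> p0 y0; apply: (le_lt_trans (egammaG_le _ y0)).
have finN (N : nat) : (egammaG N.+1%:R 0 < +oo)%E.
  elim: N => [|N IH]; first by rewrite egammaG10 ltry.
  by rewrite -natr1 egammaG_rec// mul0e adde0 lte_mul_pinfty// lee_fin.
(* This product is G_(p+1)(0), whose integrand has the positive exponent p: then s^p <= 1 + s^N with
   N >= p, which fails near 0 for a negative exponent. *)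
suff : (p%:E * egammaG p 0 < +oo)%E.
  by apply: contraTT; rewrite -!leNgt !leye_eq => /eqP ->; rewrite gt0_muley ?lte_fin.
have := egammaG_rec p0 (lexx 0); rewrite mul0e adde0 => <-.
pose N := (Num.truncn p).+1.
apply: (@le_lt_trans _ _ (egammaG 1 0 + egammaG N.+1%:R 0)%E); last by apply: lte_add_pinfty; [exact: (finN 0%N)|exact: finN].
rewrite /egammaG -ge0_integralD//; last 4 first.
- by move=> s _; rewrite lee_fin gker_ge0.
- by apply/measurable_EFinP; exact: measurable_gker.
- by move=> s _; rewrite lee_fin gker_ge0.
- by apply/measurable_EFinP; exact: measurable_gker.
apply: ge0_le_integral => //.
- by move=> s _; rewrite lee_fin gker_ge0.
- by apply/measurable_EFinP; exact: measurable_gker.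
- by apply/measurable_EFinP; apply: measurable_funD; exact: measurable_gker.
move=> s /=; rewrite in_itv/= andbT => s0; rewrite -EFinD lee_fin addrK.
rewrite !gker0 subrr powRr0 -mulrDl ler_wpM2r ?expR_ge0// -natr1 addrK.
have [s1|/ltW s1] := leP s 1.
  apply: (@le_trans _ _ 1); last by rewrite lerDl powR_ge0.
  by rewrite -(powRr0 s) ger_powR ?s0// ltW.
rewrite (@le_trans _ _ (s `^ N%:R))// ?lerDr// ler_powR//.
exact/ltW/truncnS_gt.
Qed.

(** On [1, 2] the integrand is at least 2^(-|p-1|) exp(-2), whatever the sign of p - 1. *)
Lemma egammaG0_gt0 p : (0 < egammaG p 0)%E.
Proof.
pose q := `|p - 1|.
pose c : R := (2 `^ q)^-1 * expR (- 2).
have c0 : 0 < c by rewrite mulr_gt0 ?expR_gt0// invr_gt0 powR_gt0.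
apply: (@lt_le_trans _ _ (\int[mu]_(s in `[1%R, 2%R]) c%:E)%E).
  rewrite integral_cst//= lebesgue_measure_itv/= lte_fin ltr1n/=.
  by rewrite -EFinB -EFinM lte_fin mulr_gt0// subr_gt0 ltr1n.
apply: (@le_trans _ _ (\int[mu]_(s in `[1%R, 2%R]) (gker (p - 1) 0 s)%:E)%E).
  have sub : `[1%R, 2%R] `<=` (`]0, +oo[ : set R).
    by move=> s /=; rewrite !in_itv/= andbT => /andP[+ _]; exact: lt_le_trans.
  apply: ge0_le_integral => //.
  - by move=> s _; rewrite lee_fin ltW.
  - by apply/measurable_EFinP; apply: measurable_funS (measurable_gker _ _).
  move=> s /=; rewrite in_itv/= => /andP[s1 s2]; rewrite lee_fin gker0.
  have s0 : 0 < s by exact: lt_le_trans s1.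
  rewrite ler_pM ?expR_ge0 ?invr_ge0 ?powR_ge0//; last by rewrite ler_expR lerN2.
  apply: (@le_trans _ _ (s `^ (- q))).
    rewrite powRN lef_pV2 ?posrE ?powR_gt0//.
    by rewrite ge0_ler_powR ?nnegrE ?(ltW s0) /q.
  by rewrite ler_powR// lerNl /q -normrN ler_norm.
apply: ge0_subset_integral => //.
- by apply/measurable_EFinP; exact: measurable_gker.
- by move=> s _; rewrite lee_fin gker_ge0.
- by move=> s /=; rewrite !in_itv/= andbT => /andP[+ _]; exact: lt_le_trans.
Qed.

Definition gammaG p y : R := fine (egammaG p y).

Lemma gammaGE p y : 0 < p -> 0 <= y -> (gammaG p y)%:E = egammaG p y.
Proof. by move=> p0 y0; rewrite fineK// ge0_fin_numE ?egammaG_ge0 ?egammaG_fin. Qed.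

Lemma gammaG_ge0 p y : 0 <= gammaG p y.
Proof. exact/fine_ge0/egammaG_ge0. Qed.

Lemma gammaG0_gt0 p : 0 < p -> 0 < gammaG p 0.
Proof. by move=> p0; rewrite -lte_fin gammaGE// egammaG0_gt0. Qed.

Lemma gammaG_le p y z : 0 < p -> 0 <= y -> y <= z -> gammaG p z <= gammaG p y.
Proof.
by move=> p0 y0 yz; rewrite -lee_fin !gammaGE ?egammaG_le// (le_trans y0).
Qed.

(** The recurrence with its last nonnegative term dropped. Arguing in the extended reals covers 0 <
    p <= 1, where G_(p-1)(y) may be infinite. *)
Lemma gammaG_ge_rec p y : 0 < p -> 0 <= y -> p * gammaG p y <= gammaG (p + 1) y.
Proof.
move=> p0 y0; rewrite -lee_fin EFinM !gammaGE// ?addr_gt0// egammaG_rec// leeDl//.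
by rewrite mule_ge0 ?egammaG_ge0.
Qed.

(** The condition [1 < p] keeps the order p - 1 positive, so that all three integrals are finite and
    [fine] loses nothing. *)
Lemma gammaG_rec p y : 1 < p -> 0 <= y -> gammaG (p + 1) y = p * gammaG p y + y * gammaG (p - 1) y.
Proof.
move=> p1 y0; have p0 : 0 < p by exact: lt_trans p1.
have p10 : 0 < p - 1 by rewrite subr_gt0.
by apply: EFin_inj; rewrite EFinD !EFinM !gammaGE ?egammaG_rec// addr_gt0.
Qed.

Lemma gammaG0_rec p : 0 < p -> gammaG (p + 1) 0 = p * gammaG p 0.
Proof.
move=> p0.
by apply: EFin_inj; rewrite EFinM !gammaGE ?egammaG_rec ?addr_gt0// mul0e adde0.
Qed.

Lemma euler_integralE p : euler_integral p = gammaG p 0.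
Proof.
rewrite /euler_integral /Rintegral /gammaG /egammaG; congr fine.
by apply: eq_integral => s _; rewrite gker0.
Qed.

End gamma_kernel.

(** * K_p in terms of G_p *)

Section besselK.
Context {R : realType}.
Implicit Types (p x y s t b : R).
Notation mu := (@lebesgue_measure R).

(** The integrand of K_p with exp(p t) in place of cosh(p t): this is the form that the substitution
    s = (x/2) exp(t) produces on the whole line. *)
Definition bkerK p x t : R := expR (p * t) * expR (- (x * cosh t)).

Lemma bkerK_ge0 p x t : 0 <= bkerK p x t.
Proof. by rewrite mulr_ge0 ?expR_ge0. Qed.

Lemma continuous_expRM p : continuous (fun t : R => expR (p * t)).
Proof.
move=> t; apply: (@continuous_comp _ _ _ ( *%R p) expR).
  exact: mulrl_continuous.
exact: continuous_expR.
Qed.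

Lemma continuous_cosh : continuous (@cosh R).
Proof.
move=> t; rewrite /cosh; apply: cvgMl; apply: cvgD; first exact: continuous_expR.
have := @continuous_expRM (-1) t; rewrite /continuous_at.
by under eq_fun do rewrite mulN1r; rewrite mulN1r.
Qed.

Lemma bkerK_continuous p x : continuous (bkerK p x).
Proof.
move=> t; apply: cvgM; first exact: continuous_expRM.
apply: (@continuous_comp _ _ _ (fun t => - (x * cosh t)) expR).
  by apply: cvgN; apply: cvgMr; exact: continuous_cosh.
exact: continuous_expR.
Qed.

Lemma continuous_kerK p x : continuous (fun t : R => expR (- (x * cosh t)) * cosh (p * t)).
Proof.
move=> t; apply: cvgM.
  apply: (@continuous_comp _ _ _ (fun t => - (x * cosh t)) expR).
    by apply: cvgN; apply: cvgMr; exact: continuous_cosh.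
  exact: continuous_expR.
apply: (@continuous_comp _ _ _ ( *%R p) cosh).
  exact: mulrl_continuous.
exact: continuous_cosh.
Qed.

Lemma kerK_ge0 p x t : 0 <= expR (- (x * cosh t)) * cosh (p * t).
Proof. by rewrite mulr_ge0 ?expR_ge0// divr_ge0// addr_ge0 ?expR_ge0. Qed.

Lemma coshN t : cosh (- t) = cosh t.
Proof. by rewrite /cosh opprK addrC. Qed.

Lemma measurable_bkerK (D : set R) p x : measurable D ->
  measurable_fun D (EFin \o bkerK p x).
Proof.
move=> mD; apply/measurable_EFinP; apply: measurable_funTS.
by apply: continuous_measurable_fun; exact: bkerK_continuous.
Qed.

(** Fold the negative half onto the positive one: exp(p t) + exp(-p t) = 2 cosh(p t), while cosh t
    is even. *)
Lemma integral_bkerK_sym p x b : 0 <= b ->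
  (\int[mu]_(t in `[(- b)%R, b]) (bkerK p x t)%:E =
   2%:E * \int[mu]_(t in `[0%R, b]) (expR (- (x * cosh t)) * cosh (p * t))%:E)%E.
Proof.
move=> b0.
have mN : measurable_fun `[0%R, b] (EFin \o (bkerK p x \o -%R)).
  apply/measurable_EFinP; apply: measurable_funTS.
  apply: continuous_measurable_fun => t; apply: continuous_comp.
    exact: opp_continuous.
  exact: bkerK_continuous.
rewrite (_ : `[- b, b]%classic = `[- b, 0] `|` `]0, b]); last first.
  by rewrite -itv_bndbnd_setU// bnd_simp// oppr_le0.
rewrite ge0_integral_setU//=; last 3 first.
- by apply: measurable_bkerK; exact: measurableU.
- by move=> t _; rewrite lee_fin bkerK_ge0.
- apply/disj_setPS => t [] /=; rewrite !in_itv/= => /andP[_ t0] /andP[+ _].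
  by rewrite ltNge t0.
have := @integration_by_substitution_oppr R (bkerK p x) 0 b b0.
rewrite oppr0 => ->; last by apply: continuous_subspaceT; exact: bkerK_continuous.
rewrite integral_itv_obnd_cbnd; last exact: measurable_bkerK.
rewrite -ge0_integralD//; last 3 first.
- by move=> t _; rewrite lee_fin bkerK_ge0.
- by move=> t _; rewrite lee_fin bkerK_ge0.
- exact: measurable_bkerK.
transitivity (\int[mu]_(t in `[0%R, b])
    (2%:E * (expR (- (x * cosh t)) * cosh (p * t))%:E))%E.
  apply: eq_integral => t _; rewrite -EFinD -EFinM /bkerK /= coshN /cosh mulrN.
  by congr EFin; field.
rewrite ge0_integralZl_EFin//.
- by move=> t _; rewrite lee_fin kerK_ge0.
- apply/measurable_EFinP; apply: measurable_funTS; apply: continuous_measurable_fun.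
  exact: continuous_kerK.
Qed.

(** Substitute s = (x/2) exp(t): ds/s = dt, and s + (x^2/4)/s = x cosh t. *)
Lemma integral_gker_subst p x b : 0 < x -> 0 <= b ->
  (\int[mu]_(s in `[(x / 2 * expR (- b))%R, (x / 2 * expR b)%R])
     (gker (p - 1) (x ^+ 2 / 4) s)%:E =
   ((x / 2) `^ p)%:E * \int[mu]_(t in `[(- b)%R, b]) (bkerK p x t)%:E)%E.
Proof.
move=> x0 b0; have x20 : 0 < x / 2 by rewrite divr_gt0.
pose F t : R := x / 2 * expR t.
have dF t : is_derive t 1 F (F t).
  exact: (is_deriveZ (x / 2) (is_derive_expR t)).
have cF : continuous F by move=> t; exact: is_derive1_continuous.
have F'E : derive1 F = F.
  by apply/funext => t; rewrite derive1E; exact: derive_val.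
rewrite (@integration_by_substitution_increasing _ F).
- rewrite F'E -ge0_integralZl_EFin//; last 3 first.
  + by move=> t _; rewrite lee_fin bkerK_ge0.
  + exact: measurable_bkerK.
  + exact: powR_ge0.
  apply: eq_integral => t _; rewrite -EFinM; congr EFin.
  have Ft0 : 0 < F t by rewrite mulr_gt0 ?expR_gt0.
  transitivity (gker (p - 1) (x ^+ 2 / 4) (F t) * F t); first by [].
  rewrite /gker powRB1// (_ : F t + _ = x * cosh t); last first.
    rewrite /F /cosh expRN; field.
    by rewrite !gt_eqF ?expR_gt0.
  have -> : F t `^ p = (x / 2) `^ p * expR (p * t).
    rewrite [F t]/F [LHS]powRM ?expR_ge0 ?(ltW x20)//; congr (_ * _).
    by rewrite /powR gt_eqF ?expR_gt0// expRK.
  by rewrite /bkerK; field; rewrite gt_eqF.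
- lra.
- by move=> s t _ _ st; rewrite /F ltr_pM2l// ltr_expR.
- by rewrite F'E => t _; exact: cF.
- by rewrite F'E; apply/cvg_ex; exists (F (- b)); apply: cvg_at_right_filter; exact: cF.
- by rewrite F'E; apply/cvg_ex; exists (F b); apply: cvg_at_left_filter; exact: cF.
- split; [by []|by apply: cvg_at_right_filter; exact: cF|by apply: cvg_at_left_filter; exact: cF].
- apply: continuous_in_within => s /=; rewrite in_itv/= => /andP[+ _] => h.
  by apply: gker_continuous; apply: lt_le_trans h; rewrite mulr_gt0 ?expR_gt0.
Qed.

(** The substitution and the folding are made on compact segments; both sides are then limits of the
    same sequence. *)
Lemma besselKE p x : 0 < x -> 0 < p ->
  besselK p x = gammaG p (x ^+ 2 / 4) / (2 * (x / 2) `^ p).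
Proof.
move=> x0 p0; have x20 : 0 < x / 2 by rewrite divr_gt0.
pose kK t := expR (- (x * cosh t)) * cosh (p * t).
have ckK : continuous kK := @continuous_kerK p x.
have kK0 t : 0 <= kK t by exact: kerK_ge0.
have L1 : (\int[mu]_(t in `[0%R, m.+1%:R]) (kK t)%:E)%E @[m --> \oo] -->
    (\int[mu]_(t in `[0%R, +oo[) (kK t)%:E)%E.
  apply: (@cvg_integral_exhaust _ kK (fun=> 0)) => //.
  - by move=> m n mn; rewrite ler_nat ltnS.
  - apply/seteqP; split => [t|t [m _]] /=; rewrite !in_itv/= ?andbT; last by case/andP.
    move=> t0; exists (Num.truncn t) => //=; rewrite in_itv/= t0/=.
    exact/ltW/truncnS_gt.
  - by move=> t _; exact: ckK.
have L2 : (\int[mu]_(s in `[(x / 2 * expR (- m.+1%:R))%R, (x / 2 * expR m.+1%:R)%R])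
     (gker (p - 1) (x ^+ 2 / 4) s)%:E)%E @[m --> \oo] --> egammaG p (x ^+ 2 / 4).
  apply: cvg_integral_exhaust => //.
  - by move=> m n mn; rewrite ler_pM2l// ler_expR lerN2 ler_nat ltnS.
  - by move=> m n mn; rewrite ler_pM2l// ler_expR ler_nat ltnS.
  - apply/seteqP; split => [s|s [m _]] /=; rewrite !in_itv/= ?andbT; last first.
      by move=> /andP[+ _]; apply: lt_le_trans; rewrite mulr_gt0 ?expR_gt0.
    move=> s0; have r0 : 0 < s / (x / 2) by rewrite divr_gt0.
    exists (Num.truncn `|ln (s / (x / 2))|) => //=; rewrite in_itv/=.
    have := ltW (truncnS_gt `|ln (s / (x / 2))|).
    rewrite ler_norml => /andP[h1 h2].
    have sE : s = x / 2 * expR (ln (s / (x / 2))).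
      by rewrite lnK ?posrE//; field; rewrite gt_eqF.
    by rewrite [X in _ <= X <= _]sE !ler_pM2l// !ler_expR h1 h2.
  - by move=> s /=; rewrite in_itv/= andbT => s0; exact: gker_continuous.
  - by move=> s _; exact: gker_ge0.
have c0 : 0 < (x / 2) `^ p * 2 by rewrite mulr_gt0 ?powR_gt0.
have L3 : (((x / 2) `^ p * 2)%:E * \int[mu]_(t in `[0%R, m.+1%:R]) (kK t)%:E)%E @[m --> \oo] -->
    (((x / 2) `^ p * 2)%:E * \int[mu]_(t in `[0%R, +oo[) (kK t)%:E)%E.
  by apply: cvgeZl.
have E : (((x / 2) `^ p * 2)%:E * \int[mu]_(t in `[0%R, +oo[) (kK t)%:E)%E = egammaG p (x ^+ 2 / 4).
  apply: (cvg_unique _ L3); first by [].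
  rewrite (_ : (fun m => _) = (fun m => (\int[mu]_(s in `[(x / 2 * expR (- m.+1%:R))%R, (x / 2 * expR m.+1%:R)%R])
     (gker (p - 1) (x ^+ 2 / 4) s)%:E)%E))//.
  by apply/funext => m; rewrite integral_gker_subst// integral_bkerK_sym// muleA.
(* [fineM] asks that the integral of [kK] be finite: an infinite value times a positive constant
   would make G_p infinite. *)
rewrite /besselK /Rintegral /gammaG -E fineM//; last first.
  rewrite ge0_fin_numE; last by apply: integral_ge0 => t _; rewrite lee_fin.
  have := egammaG_fin p0 (_ : 0 <= x ^+ 2 / 4); rewrite -E => h.
  have {}h := h (divr_ge0 (sqr_ge0 _) (ler0n _ _)).
  move: h; apply: contraTT; rewrite -!leNgt !leye_eq => /eqP ->.
  by rewrite gt0_muley ?lte_fin.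
by rewrite /= [in RHS]mulrC mulrA [2 * _]mulrC mulVf ?mul1r// gt_eqF.
Qed.

End besselK.

(** * The series B_p(y) and the product B_(p+1) G_p *)

Section series_I.
Context {R : realType}.
Implicit Types (p y : R) (k n : nat).

Definition bcoef p y k : R := y ^+ k / (k`!%:R * gammaG (p + k%:R) 0).

Definition besselB p y : R := limn (series (bcoef p y)).

Lemma gammaG0D_gt0 p k : 0 < p -> 0 < gammaG (p + k%:R) 0.
Proof. by move=> p0; rewrite gammaG0_gt0// ltr_wpDr. Qed.

Lemma natr_fact_gt0 k : 0 < k`!%:R :> R.
Proof. by rewrite ltr0n fact_gt0. Qed.

Lemma bcoef_ge0 p y k : 0 < p -> 0 <= y -> 0 <= bcoef p y k.
Proof.
move=> p0 y0; rewrite divr_ge0 ?exprn_ge0// mulr_ge0 ?ler0n//.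
exact/ltW/gammaG0D_gt0.
Qed.

Lemma gammaG0_expn_le p k : 0 < p -> p ^+ k * gammaG p 0 <= gammaG (p + k%:R) 0.
Proof.
move=> p0; elim: k => [|k IH]; first by rewrite mul1r addr0.
rewrite -natr1 addrA gammaG0_rec ?ltr_wpDr// exprS -mulrA ler_pM ?lerDl//.
- exact: ltW.
- by rewrite mulr_ge0 ?gammaG_ge0// exprn_ge0// ltW.
Qed.

(** Since Gamma(p+k) >= p^k Gamma(p), the series is dominated by that of exp(y/p)/Gamma(p). This
    gives convergence as well as the bound [besselB_le]. *)
Lemma bcoef_le p y k : 0 < p -> 0 <= y ->
  bcoef p y k <= ((gammaG p 0)^-1 *: exp_coeff (y / p)) k.
Proof.
move=> p0 y0; have G0 := gammaG0_gt0 p0.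
apply: (@le_trans _ _ (y ^+ k / (k`!%:R * (p ^+ k * gammaG p 0)))).
  rewrite ler_wpM2l ?exprn_ge0// lef_pV2 ?posrE.
  - by rewrite ler_wpM2l ?gammaG0_expn_le.
  - by rewrite mulr_gt0 ?natr_fact_gt0 ?gammaG0D_gt0.
  - by rewrite !mulr_gt0 ?natr_fact_gt0 ?exprn_gt0.
rewrite le_eqVlt; apply/orP; left; apply/eqP.
have -> : ((gammaG p 0)^-1 *: exp_coeff (y / p)) k = (gammaG p 0)^-1 * ((y / p) ^+ k / k`!%:R) by [].
rewrite exprMn exprVn; field.
by rewrite !gt_eqF ?natr_fact_gt0 ?exprn_gt0.
Qed.

Lemma is_cvg_bcoef p y : 0 < p -> 0 <= y -> cvgn (series (bcoef p y)).
Proof.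
move=> p0 y0; apply: (@series_le_cvg _ _ ((gammaG p 0)^-1 *: exp_coeff (y / p))).
- by move=> k; exact: bcoef_ge0.
- by move=> k; apply: le_trans (bcoef_le k p0 y0); exact: bcoef_ge0.
- by move=> k; exact: bcoef_le.
- by apply: is_cvg_seriesZ; exact: is_cvg_series_exp_coeff.
Qed.

Lemma besselB_le p y : 0 < p -> 0 <= y -> besselB p y <= expR (y / p) / gammaG p 0.
Proof.
move=> p0 y0; rewrite mulrC.
rewrite -[_ * _]/(_ *: limn (series (exp_coeff (y / p)))) -lim_seriesZ; last first.
  exact: is_cvg_series_exp_coeff.
apply: lim_series_le.
- exact: is_cvg_bcoef.
- by apply: is_cvg_seriesZ; exact: is_cvg_series_exp_coeff.
- by move=> k; exact: bcoef_le.
Qed.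

Lemma besselB_ge0 p y : 0 < p -> 0 <= y -> 0 <= besselB p y.
Proof.
move=> p0 y0; apply: limr_ge; first exact: is_cvg_bcoef.
by apply: nearW => n; apply: sumr_ge0 => k _; exact: bcoef_ge0.
Qed.

(** Write 1/Gamma(p+k) = (p+k)/Gamma(p+k+1) and split p + k. The part with k cancels a factor of k!
    and shifts the index, so its sum has one term fewer. *)
Lemma series_bcoef_rec p y n : 0 < p ->
  series (bcoef p y) n.+1 =
  p * series (bcoef (p + 1) y) n.+1 + y * series (bcoef (p + 2) y) n.
Proof.
move=> p0; elim: n => [|n IH].
  rewrite /series/= !big_nat1 big_geq// mulr0 addr0 /bcoef !addr0 gammaG0_rec//.
  by field; rewrite !gt_eqF ?gammaG0_gt0.
have -> : series (bcoef p y) n.+2 = _ := seriesSr _ _.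
have -> : series (bcoef (p + 1) y) n.+2 = _ := seriesSr _ _.
have -> : series (bcoef (p + 2) y) n.+1 = _ := seriesSr _ _.
rewrite IH !mulrDr [RHS]addrACA; congr +%R.
rewrite /bcoef.
have -> : p + 2 + n%:R = p + n.+1%:R + 1 by rewrite -natr1; ring.
have -> : p + 1 + n.+1%:R = p + n.+1%:R + 1 by ring.
have pn : 0 < p + n.+1%:R by rewrite ltr_wpDr.
rewrite gammaG0_rec// factS natrM exprS.
have n1 : n.+1%:R = n%:R + 1 :> R by rewrite natr1.
rewrite n1 in pn *.
by field; rewrite !gt_eqF ?natr_fact_gt0 ?gammaG0_gt0// -n1 ltr0n.
Qed.

Lemma besselB_rec p y : 0 < p -> 0 <= y -> besselB p y = p * besselB (p + 1) y + y * besselB (p + 2) y.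
Proof.
move=> p0 y0; apply: cvg_lim => //.
rewrite -cvg_shiftS; under eq_fun do rewrite series_bcoef_rec//.
apply: cvgD; apply: cvgMr; last by apply: is_cvg_bcoef => //; exact: addr_gt0.
have : cvgn (series (bcoef (p + 1) y)) by apply: is_cvg_bcoef => //; exact: addr_gt0.
by rewrite /besselB => h; rewrite (cvg_shiftS (series (bcoef (p + 1) y))).
Qed.

(** For y = x^2/4 with x > 0 this is x (I_(p-1)(x) K_p(x) + I_p(x) K_(p-1)(x)), the classical
    Wronskian up to the factor x. *)
Definition wronsk p y : R := besselB p y * gammaG p y + y * (besselB (p + 1) y * gammaG (p - 1) y).

(** Expanding G_(p+1) on one side and B_p on the other gives p B_(p+1) G_p + y B_(p+2) G_p + y
    B_(p+1) G_(p-1) both times. *)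
Lemma wronskS p y : 1 < p -> 0 <= y -> wronsk (p + 1) y = wronsk p y.
Proof.
move=> p1 y0; have p0 : 0 < p by exact: lt_trans p1.
rewrite /wronsk addrK (_ : p + 1 + 1 = p + 2); last by ring.
move: (besselB_rec p0 y0) (gammaG_rec p1 y0).
move: (besselB p y) (besselB (p + 1) y) (besselB (p + 2) y) (gammaG (p + 1) y) (gammaG p y) (gammaG (p - 1) y).
by move=> b0 b1 b2 g2 g1 g0 -> ->; ring.
Qed.

Lemma wronskD p y n : 1 < p -> 0 <= y -> wronsk (p + n%:R) y = wronsk p y.
Proof.
move=> p1 y0; elim: n => [|n IH]; first by rewrite addr0.
by rewrite -natr1 addrA wronskS ?ltr_wpDr.
Qed.

(** From G_p(y) <= Gamma(p) and B_p(y) <= exp(y/p)/Gamma(p) the total is at most exp(y/p) (1 +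
    y/(p-1)), and each factor is at most exp(y/(p-1)). *)
Lemma wronsk_le p y : 1 < p -> 0 <= y -> wronsk p y <= expR (2 * y / (p - 1)).
Proof.
move=> p1 y0; have p0 : 0 < p by exact: lt_trans p1.
have q0 : 0 < p - 1 by rewrite subr_gt0.
have Gp : gammaG p 0 = (p - 1) * gammaG (p - 1) 0 by have := gammaG0_rec q0; rewrite subrK.
have h1 : besselB p y * gammaG p y <= expR (y / p).
  apply: (@le_trans _ _ (expR (y / p) / gammaG p 0 * gammaG p 0)).
    by rewrite ler_pM ?besselB_ge0 ?gammaG_ge0 ?besselB_le ?gammaG_le.
  by rewrite mulfVK// gt_eqF ?gammaG0_gt0.
have h2 : besselB (p + 1) y * gammaG (p - 1) y <= expR (y / p) / (p * (p - 1)).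
  apply: (@le_trans _ _ (expR (y / p) / gammaG (p + 1) 0 * gammaG (p - 1) 0)).
    rewrite ler_pM ?besselB_ge0 ?gammaG_ge0 ?addr_gt0 ?gammaG_le//.
    apply: (le_trans (besselB_le _ y0)); first exact: addr_gt0.
    rewrite ler_wpM2r ?invr_ge0 ?gammaG_ge0// ler_expR ler_wpM2l//.
    by rewrite lef_pV2 ?posrE ?addr_gt0// lerDl.
  rewrite gammaG0_rec// Gp le_eqVlt; apply/orP; left; apply/eqP.
  by field; rewrite !gt_eqF ?gammaG0_gt0.
have h3 : y * (besselB (p + 1) y * gammaG (p - 1) y) <= expR (y / p) * (y / (p - 1)).
  apply: (le_trans (ler_wpM2l y0 h2)).
  rewrite mulrCA ler_wpM2l ?expR_ge0// ler_wpM2l// lef_pV2 ?posrE ?mulr_gt0//.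
  by rewrite ler_peMl ?(ltW q0)// ltW.
apply: (@le_trans _ _ (expR (y / p) * (1 + y / (p - 1)))).
  by rewrite mulrDr mulr1; exact: lerD.
have -> : 2 * y / (p - 1) = y / (p - 1) + y / (p - 1) by field; rewrite gt_eqF.
rewrite expRD ler_pM ?expR_ge0 ?expR_ge1Dx//.
  by rewrite addr_ge0// divr_ge0// ltW.
by rewrite ler_expR ler_wpM2l// lef_pV2 ?posrE// gerBl.
Qed.

Lemma wronsk_le1 p y : 1 < p -> 0 <= y -> wronsk p y <= 1.
Proof.
move=> p1 y0; rewrite leNgt; apply/negP => w1.
have l0 : 0 < ln (wronsk p y) by exact: ln_gt0.
(* If W = [wronsk p y] exceeded 1, this n would make 2y/(p+n-1) < ln W, against [wronsk_le] at order
   p + n. *)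
pose n := (Num.truncn (2 * y / ln (wronsk p y))).+1.
have hn : 2 * y / ln (wronsk p y) < n%:R := truncnS_gt _.
have := @wronsk_le (p + n%:R) y; rewrite wronskD// ltr_wpDr// => /(_ isT y0).
rewrite -ler_ln ?posrE ?expR_gt0 ?(lt_trans ltr01)// expRK.
have pn : 0 < p + n%:R - 1 by have : 0 <= n%:R :> R by []; lra.
rewrite ler_pdivlMr//; apply/negP; rewrite -ltNge.
move: hn; rewrite ltr_pdivrMr// => hn; apply: (lt_le_trans hn).
by rewrite mulrC ler_wpM2l ?(ltW l0)//; lra.
Qed.

(** Absorbing p into G_(p+1) raises the order to p + 1 > 1, where [wronsk_le1] applies. *)
Lemma besselB_gammaG_le1 p y : 0 < p -> 0 <= y -> p * (besselB (p + 1) y * gammaG p y) <= 1.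
Proof.
move=> p0 y0; have p10 : 0 < p + 1 by exact: addr_gt0.
apply: (@le_trans _ _ (wronsk (p + 1) y)); last by rewrite wronsk_le1// ltrDr.
apply: (@le_trans _ _ (besselB (p + 1) y * gammaG (p + 1) y)).
  by rewrite mulrCA ler_wpM2l ?besselB_ge0 ?gammaG_ge_rec.
rewrite lerDl mulr_ge0// mulr_ge0 ?gammaG_ge0// besselB_ge0// addr_gt0//.
Qed.

End series_I.

(** * Repeated integrals of x^nu I_nu(x) *)

Section repeated_integral.
Context {R : realType}.
Implicit Types (p x y nu : R) (k n : nat).
Notation mu := (@lebesgue_measure R).

(** For p < 0 the integrand is unbounded near 0, so the primitive is used on segments away from 0;
    its lower boundary value tends to 0 because p + 1 > 0. *)
Lemma integral_powR_oc p x : -1 < p -> 0 < x ->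
  (\int[mu]_(s in `]0%R, x]) (s `^ p)%:E = (x `^ (p + 1) / (p + 1))%:E)%E.
Proof.
move=> p1 x0; have p10 : 0 < p + 1 by rewrite -ltrBlDr sub0r.
suff : (\int[mu]_(s in `]0%R, x]) (s `^ p)%:E + 0%:E =
    \int[mu]_(s in `]0%R, x]) 0%:E + (x `^ (p + 1) / (p + 1))%:E)%E.
  by rewrite integral0 add0e adde0.
have dF (s : R) : 0 < s -> is_derive s 1 (fun s => s `^ (p + 1) / (p + 1)) (s `^ p - 0).
  move=> s0; have := is_deriveZ (p + 1)^-1 (is_derive1_powR (p + 1) s0).
  rewrite /GRing.scale/= addrK mulrA mulVf ?gt_eqF// mul1r subr0 => h.
  by under eq_fun do rewrite mulrC.
have cV : x * (m.+2%:R)^-1 @[m --> \oo] --> 0.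
  rewrite -[X in _ --> X](mulr0 x); apply: cvgM; first exact: cvg_cst.
  exact: cvg_inv_nat2.
apply: (integral_exhaust_FTC (F := fun s => s `^ (p + 1) / (p + 1))
  (a := fun m => x * (m.+2%:R)^-1) (b := fun=> x)).
- by move=> m n mn; rewrite ler_pM2l//; exact: nonincreasing_invS2.
- by [].
- by move=> m; rewrite gtr_pMr// invf_lt1// ltr1n.
- exact: itv_oc_bigcup.
- move=> s /=; rewrite in_itv/= => /andP[s0 _].
  by have := is_derive1_powR p s0; exact: is_derive1_continuous.
- by move=> s _; exact: powR_ge0.
- by move=> s _; exact: cvg_cst.
- by [].
- by move=> s /=; rewrite in_itv/= => /andP[s0 _]; exact: dF.
- rewrite -[X in _ --> X](mul0r (p + 1)^-1); apply: cvgM; last exact: cvg_cst.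
  have /cvg_at_rightP := powR_cvg0 p10; apply; split => // m.
  by rewrite mulr_gt0.
- exact: cvg_cst.
Qed.

(** The denominator produced by integrating x^(2 nu + 2k) n times from 0. *)
Definition idenom nu n k : R := \prod_(j < n) (2 * nu + 2 * k%:R + 1 + j%:R).

Definition icoef nu n y k : R := bcoef (nu + 1) y k / idenom nu n k.

Definition Iser nu n y : R := limn (series (icoef nu n y)).

Section order.
Variable nu : R.
Hypothesis hnu : - (1 / 2) < nu.

Let nu1_gt0 : 0 < nu + 1. Proof. by have := hnu; lra. Qed.
Let nu21_gt0 : 0 < 2 * nu + 1. Proof. by have := hnu; lra. Qed.

Lemma ifactor_gt0 k j : 0 < 2 * nu + 2 * k%:R + 1 + j%:R.
Proof. by have := hnu; have := ler0n R k; have := ler0n R j; lra. Qed.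

Lemma idenom_gt0 n k : 0 < idenom nu n k.
Proof. by apply: prodr_gt0 => j _; exact: ifactor_gt0. Qed.

Lemma icoef_ge0 n y k : 0 <= y -> 0 <= icoef nu n y k.
Proof. by move=> y0; rewrite divr_ge0 ?bcoef_ge0// ltW// idenom_gt0. Qed.

(** Induction from n = 1, the inequality being false at n = 0. At n = 1 the polynomial factors
    differ by exactly k; each further step multiplies the left by nu + n + 1 + k and the right by a
    factor of [idenom], and compares quadratic expressions. *)
Lemma gammaG0_idenom_le n k : (0 < n)%N ->
  gammaG (nu + n%:R + 1 + k%:R) 0 * (2 * nu + 1) <=
  (nu + n%:R) * (gammaG (nu + 1 + k%:R) 0 * idenom nu n k).
Proof.
have nu_gt := hnu.
have k0 := ler0n R k.
have Gk : 0 < gammaG (nu + 1 + k%:R) 0 by rewrite gammaG0D_gt0.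
case: n => // n _; elim: n => [|n IH].
  rewrite /idenom big_ord1 addr0.
  have -> : nu + 1 + 1 + k%:R = nu + 1 + k%:R + 1 by ring.
  rewrite gammaG0_rec; last by rewrite ltr_wpDr.
  have h : (nu + 1 + k%:R) * (2 * nu + 1) <= (nu + 1) * (2 * nu + 2 * k%:R + 1) by nra.
  by rewrite mulrAC [X in _ <= _ * X]mulrC mulrA ler_pM2r.
rewrite /idenom big_ord_recr/= -/(idenom nu n.+1 k).
have n0 := ler0n R n; set N : R := n.+1%:R in IH *.
have N1 : N = n%:R + 1 by rewrite /N natr1.
have -> : n.+2%:R = N + 1 by rewrite /N natr1.
have -> : nu + (N + 1) + 1 + k%:R = nu + N + 1 + k%:R + 1 by ring.
rewrite (@gammaG0_rec _ (nu + N + 1 + k%:R)); last by rewrite N1; lra.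
have := idenom_gt0 n.+1 k; set D := idenom _ _ _ in IH *; move=> D0.
have q0 : 0 <= nu + N + 1 + k%:R by rewrite N1; lra.
rewrite -mulrA; apply: (le_trans (ler_wpM2l q0 IH)).
rewrite [X in _ <= X](_ : _ = ((nu + (N + 1)) * (2 * nu + 2 * k%:R + 1 + N)) *
  (gammaG (nu + 1 + k%:R) 0 * D)); last by ring.
rewrite [X in X <= _]mulrA ler_wpM2r ?mulr_ge0 ?(ltW Gk) ?(ltW D0)//.
nra.
Qed.

Lemma icoef_le n y k : (0 < n)%N -> 0 <= y ->
  icoef nu n y k <= ((nu + n%:R) / (2 * nu + 1) *: bcoef (nu + n%:R + 1) y) k.
Proof.
have nu_gt := hnu.
move=> n0 y0; rewrite /icoef.
rewrite [X in _ <= X](_ : _ = (nu + n%:R) / (2 * nu + 1) * bcoef (nu + n%:R + 1) y k)//.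
have n1 : 1 <= n%:R :> R by rewrite ler1n.
have nun : 0 < nu + n%:R by lra.
have G1 : 0 < gammaG (nu + 1 + k%:R) 0 by rewrite gammaG0D_gt0.
have G2 : 0 < gammaG (nu + n%:R + 1 + k%:R) 0 by rewrite gammaG0D_gt0// addr_gt0.
have D0 := idenom_gt0 n k; have f0 := natr_fact_gt0 (R := R) k.
have := gammaG0_idenom_le k n0; rewrite /bcoef.
set g1 := gammaG _ 0 in G1 *; set g2 := gammaG _ 0 in G2 *; set D := idenom _ _ _ in D0 *.
move=> h.
have c0 : 0 <= y ^+ k / k`!%:R by rewrite divr_ge0 ?exprn_ge0// ltW.
rewrite (_ : y ^+ k / _ / D = y ^+ k / k`!%:R * (g1 * D)^-1); last first.
  by field; rewrite !gt_eqF.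
rewrite (_ : (nu + _) / _ * _ = y ^+ k / k`!%:R * ((nu + n%:R) / ((2 * nu + 1) * g2))); last first.
  by field; rewrite !gt_eqF.
rewrite ler_wpM2l// -[X in X <= _]mul1r ler_pdivrMr ?mulr_gt0// mulrAC.
by rewrite ler_pdivlMr ?mulr_gt0// mul1r mulrC.
Qed.

Lemma is_cvg_icoef n y : 0 <= y -> cvgn (series (icoef nu n y)).
Proof.
have nu_gt := hnu.
(* The comparison [icoef_le] starts at n = 1; for n = 0 the denominator is an empty product and the
   series is that of B_(nu+1). *)
move=> y0; case: n => [|n].
  rewrite (_ : icoef nu 0 y = bcoef (nu + 1) y); first exact: is_cvg_bcoef.
  by apply/funext => k; rewrite /icoef /idenom big_ord0 divr1.
have n1 : 0 < nu + n.+1%:R + 1 by have := ler0n R n; rewrite -natr1; lra.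
apply: (@series_le_cvg _ _ ((nu + n.+1%:R) / (2 * nu + 1) *: bcoef (nu + n.+1%:R + 1) y)).
- by move=> k; exact: icoef_ge0.
- by move=> k; apply: (le_trans _ (icoef_le k _ y0)) => //; exact: icoef_ge0.
- by move=> k; exact: icoef_le.
- by apply: is_cvg_seriesZ; exact: is_cvg_bcoef.
Qed.

Lemma Iser_le n y : (0 < n)%N -> 0 <= y ->
  Iser nu n y <= (nu + n%:R) / (2 * nu + 1) * besselB (nu + n%:R + 1) y.
Proof.
have nu_gt := hnu.
move=> n0 y0; have n1 : 1 <= n%:R :> R by rewrite ler1n.
have c : cvgn (series (bcoef (nu + n%:R + 1) y)) by apply: is_cvg_bcoef => //; lra.
rewrite -[X in _ <= X]/(_ *: limn (series (bcoef _ y))) -lim_seriesZ//.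
apply: lim_series_le; [exact: is_cvg_icoef|exact: is_cvg_seriesZ|].
by move=> k; exact: icoef_le.
Qed.

Lemma Iser_ge0 n y : 0 <= y -> 0 <= Iser nu n y.
Proof.
move=> y0; apply: limr_ge; first exact: is_cvg_icoef.
by apply: nearW => m; apply: sumr_ge0 => k _; exact: icoef_ge0.
Qed.

Lemma Iser_homo n y z : 0 <= y -> y <= z -> Iser nu n y <= Iser nu n z.
Proof.
move=> y0 yz; have z0 := le_trans y0 yz.
apply: lim_series_le; [exact: is_cvg_icoef|exact: is_cvg_icoef|] => k.
rewrite ler_wpM2r ?invr_ge0 ?(ltW (idenom_gt0 _ _))//.
rewrite ler_wpM2r ?invr_ge0 ?mulr_ge0 ?gammaG_ge0//.
by rewrite lerXn2r ?nnegrE.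
Qed.

Definition ipow n k : R := 2 * nu + 2 * k%:R + n%:R.

(** The k-th term of I_(nu,0,n)(x) as a constant times a single power of x, ready for termwise
    integration; evaluating [icoef] at 1/4 leaves the factor 4^(-k) in the constant. *)
Definition iterm n k x : R :=
  2 `^ (- nu) * icoef nu n (1 / 4) k * x `^ ipow n k.

Lemma itermE n k x : 0 < x ->
  iterm n k x = 2 `^ (- nu) * x `^ (2 * nu + n%:R) * icoef nu n (x ^+ 2 / 4) k.
Proof.
move=> x0; rewrite /iterm /ipow /icoef /bcoef.
rewrite (_ : 2 * nu + 2 * k%:R + n%:R = 2 * nu + n%:R + (k.*2)%:R); last first.
  by rewrite -muln2 natrM; ring.
rewrite powRD ?(gt_eqF x0) ?implybT// powR_mulrn ?(ltW x0)//.
rewrite !expr_div_n expr1n -exprM mul2n.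
by field; rewrite ?gt_eqF// ?idenom_gt0 ?natr_fact_gt0 ?gammaG0D_gt0 ?exprn_gt0.
Qed.

Lemma iterm_ge0 n k x : 0 <= iterm n k x.
Proof. by rewrite mulr_ge0 ?powR_ge0// mulr_ge0 ?powR_ge0// icoef_ge0// divr_ge0. Qed.

Lemma iterm_series n x : 0 < x ->
  series (iterm n ^~ x) @ \oo --> 2 `^ (- nu) * x `^ (2 * nu + n%:R) * Iser nu n (x ^+ 2 / 4).
Proof.
move=> x0; have y0 : 0 <= x ^+ 2 / 4 by rewrite divr_ge0// sqr_ge0.
rewrite (_ : iterm n ^~ x = 2 `^ (- nu) * x `^ (2 * nu + n%:R) *: icoef nu n (x ^+ 2 / 4)); last first.
  by apply/funext => k; rewrite itermE.
by rewrite seriesZ; apply: cvgMr; exact: is_cvg_icoef.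
Qed.

Lemma iterm_nneseries n x : 0 < x ->
  (\sum_(0 <= k <oo) (iterm n k x)%:E =
   (2 `^ (- nu) * x `^ (2 * nu + n%:R) * Iser nu n (x ^+ 2 / 4))%:E)%E.
Proof.
move=> x0; rewrite -(cvg_lim _ (iterm_series (n := n) x0))// -EFin_lim; last first.
  by apply/cvg_ex; eexists; exact: iterm_series.
by apply: congr_lim; apply/funext => m /=; rewrite /series/= sumEFin.
Qed.

(** Integration raises the exponent by one and divides by it, which is the factor j = n of [idenom].
    The exponent exceeds -1 because 2 nu > -1. *)
Lemma integral_iterm n k x : 0 < x ->
  (\int[mu]_(s in `]0%R, x]) (iterm n k s)%:E = (iterm n.+1 k x)%:E)%E.
Proof.
have nu_gt := hnu.
move=> x0; rewrite /iterm.
have p1 : -1 < ipow n k by have := ler0n R k; have := ler0n R n; rewrite /ipow; lra.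
under eq_integral do rewrite EFinM.
rewrite ge0_integralZl_EFin//; last 3 first.
- by move=> s _; rewrite lee_fin powR_ge0.
- by apply/measurable_EFinP; apply: measurable_funTS; exact: measurable_powR.
- by rewrite mulr_ge0 ?powR_ge0// icoef_ge0// divr_ge0.
rewrite integral_powR_oc// -EFinM; congr EFin.
have pE : ipow n.+1 k = ipow n k + 1 by rewrite /ipow -natr1; ring.
rewrite pE /icoef /idenom big_ord_recr/= -/(idenom nu n k).
have -> : 2 * nu + 2 * k%:R + 1 + n%:R = ipow n k + 1 by rewrite /ipow; ring.
field.
by rewrite !gt_eqF ?idenom_gt0//; lra.
Qed.

(** Induction on n: the base case matches the defining series of I_nu, and the step exchanges sum
    and integral, all terms being nonnegative. *)
Lemma besselI_intE n x : 0 < x ->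
  besselI_int nu n x = 2 `^ (- nu) * x `^ (2 * nu + n%:R) * Iser nu n (x ^+ 2 / 4).
Proof.
have nu_gt := hnu.
elim: n x => [|n IH] x x0 /=.
  have x20 : 0 < x / 2 by rewrite divr_gt0.
  rewrite -(cvg_lim _ (iterm_series (n := 0%N) x0))//.
  rewrite /besselI.
  set u := (fun k : nat => _).
  have uE : iterm 0 ^~ x = x `^ nu *: u.
    apply/funext => k; rewrite itermE// -[RHS]/(x `^ nu * u k) /u /icoef /bcoef /idenom big_ord0.
    have k0 := ler0n R k.
    (* The argument is positive, so [gamma_shift] is 0 and [rgamma] is a plain inverse of Euler's
       integral. *)
    have rgE : rgamma (nu + k%:R + 1) = (gammaG (nu + 1 + k%:R) 0)^-1.
      rewrite /rgamma /gamma_shift ifT; last by lra.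
      by rewrite big_ord0 addr0 mul1r euler_integralE addrAC.
    rewrite rgE powRD ?(gt_eqF x20) ?implybT// powR_mulrn ?(ltW x20)//.
    rewrite [in RHS]powRM ?(ltW x0)// -[2^-1]powR_inv1// -powRrM mulN1r.
    rewrite addr0 (_ : 2 * nu = nu + nu); last by ring.
    rewrite powRD ?(gt_eqF x0) ?implybT// powR_inv1//.
    rewrite -mul2n exprM !expr_div_n (_ : 2 ^+ 2 = 4 :> R); last by ring.
    by field; rewrite ?gt_eqF// ?idenom_gt0 ?natr_fact_gt0 ?gammaG0D_gt0 ?exprn_gt0.
  have cu : cvgn (series u).
    have := is_cvg_seriesZ (k := (x `^ nu)^-1) (cvgP _ (iterm_series (n := 0%N) x0)).
    by rewrite uE scalerA mulVf ?scale1r// gt_eqF// powR_gt0.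
  by rewrite uE lim_seriesZ.
rewrite /Rintegral.
have eqI : {in `]0, x]%classic, (fun s => \sum_(0 <= k <oo) (iterm n k s)%:E)%E =1
    (fun s => (besselI_int nu n s)%:E)}.
  by move=> s; rewrite inE/= in_itv/= => /andP[s0 _]; rewrite iterm_nneseries// IH.
have mt k : measurable_fun `]0, x] (EFin \o iterm n k).
  apply/measurable_EFinP; apply: measurable_funM => //.
  by apply: measurable_funTS; exact: measurable_powR.
(* The null set {0} is removed because the induction hypothesis covers only positive arguments;
   measurability comes from the series. *)
rewrite -integral_itv_obnd_cbnd; last first.
  apply: (eq_measurable_fun _ eqI); apply: ge0_emeasurable_sum.
    by move=> k s _ _; rewrite lee_fin iterm_ge0.
  by move=> k _; exact: mt.
transitivity (fine (\int[mu]_(s in `]0%R, x]) \sum_(0 <= k <oo) (iterm n k s)%:E)%E).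
  by congr fine; apply: eq_integral => s sx; rewrite eqI.
rewrite integral_nneseries//; last by move=> k s _; rewrite lee_fin iterm_ge0.
by under eq_eseriesr do rewrite integral_iterm//; rewrite iterm_nneseries.
Qed.

End order.
End repeated_integral.

(** * The product *)

Section product.
Context {R : realType}.
Variables (nu : R) (n : nat).
Hypotheses (hnu : - (1 / 2) < nu) (hn : (0 < n)%N).

Let nun_gt0 : 0 < nu + n%:R.
Proof.
have n1 : 1 <= n%:R :> R by rewrite ler1n.
by have := hnu; lra.
Qed.

(** All powers of x cancel, and those of 2 leave 2^(-nu) 2^(nu+n) / 2 = 2^(n-1). *)
Lemma besselIK_posE (x : R) : 0 < x ->
  besselIK_pos nu n x =
  2 ^+ (n - 1) * (Iser nu n (x ^+ 2 / 4) * gammaG (nu + n%:R) (x ^+ 2 / 4)).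
Proof.
move=> x0; rewrite /besselIK_pos besselI_intE// besselKE//.
rewrite [(x / 2) `^ _]powRM ?(ltW x0)// -[2^-1]powR_inv1// -powRrM mulN1r !powRN.
rewrite (_ : 2 * nu + n%:R = nu + (nu + n%:R)); last by ring.
rewrite !(@powRD _ x nu) ?(gt_eqF x0) ?implybT//.
rewrite (@powRD _ 2 nu) ?pnatr_eq0 ?implybT//.
rewrite [2 `^ n%:R]powR_mulrn//.
have -> : 2 ^+ n = 2 * 2 ^+ (n - 1) :> R by rewrite -exprS subn1 prednK.
have a0 : x `^ nu != 0 by rewrite gt_eqF ?powR_gt0.
have b0 : x `^ n%:R != 0 by rewrite gt_eqF ?powR_gt0.
have c0 : 2 `^ nu != 0 :> R by rewrite gt_eqF ?powR_gt0.
have d0 : 2 ^+ (n - 1) != 0 :> R by rewrite expf_neq0.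
move: (Iser _ _ _) (gammaG _ _) => u v.
by field; rewrite ?a0 ?b0 ?c0 ?d0.
Qed.

Lemma besselIK_pos_ge0 (x : R) : 0 < x -> 0 <= besselIK_pos nu n x.
Proof.
move=> x0; have y0 : 0 <= x ^+ 2 / 4 by rewrite divr_ge0 ?sqr_ge0.
by rewrite besselIK_posE// mulr_ge0 ?exprn_ge0// mulr_ge0 ?Iser_ge0 ?gammaG_ge0.
Qed.

Lemma besselIK_pos_le (x : R) : 0 < x ->
  besselIK_pos nu n x <= 2 ^+ (n - 1) / (2 * nu + 1).
Proof.
move=> x0; rewrite besselIK_posE//; set y := x ^+ 2 / 4.
have y0 : 0 <= y by rewrite divr_ge0 ?sqr_ge0.
have nu21 : 0 < 2 * nu + 1 by have := hnu; lra.
rewrite ler_wpM2l ?exprn_ge0//.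
(* The factor nu + n from [Iser_le] is exactly the p of [besselB_gammaG_le1] at p = nu + n. *)
apply: (le_trans (ler_wpM2r (gammaG_ge0 _ _) (Iser_le hnu hn y0))).
rewrite [X in X <= _](_ : _ = (nu + n%:R) * (besselB (nu + n%:R + 1) y * gammaG (nu + n%:R) y) / (2 * nu + 1)).
  by rewrite -[X in _ <= X]mul1r ler_pM2r ?invr_gt0// besselB_gammaG_le1.
by rewrite -[LHS]mulrA [LHS]mulrAC.
Qed.

(** As x decreases to 0, the series decreases and stays above 0, while G_(nu+n) increases and stays
    below Gamma(nu+n). *)
Lemma cvg_besselIK_pos : cvg (besselIK_pos nu n y @[y --> 0^'+]).
Proof.
pose f x : R := 2 ^+ (n - 1) * (Iser nu n (x ^+ 2 / 4) * gammaG (nu + n%:R) (x ^+ 2 / 4)).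
have sq_le (u v : R) : 0 < u -> u <= v -> u ^+ 2 / 4 <= v ^+ 2 / 4.
  by move=> u0 uv; rewrite ler_wpM2r// ler_sqr ?nnegrE// ltW// (lt_le_trans u0).
have sq_ge0 (u : R) : 0 <= u ^+ 2 / 4 by rewrite divr_ge0 ?sqr_ge0.
have cI : cvg (Iser nu n (x ^+ 2 / 4) @[x --> 0^'+]).
  apply: nondecreasing_at_right_is_cvgr; apply: nearW => b.
    move=> u v; rewrite !in_itv/= => /andP[u0 _] _ uv.
    by apply: Iser_homo => //; exact: sq_le.
  by exists 0 => _ [u _ <-]; exact: Iser_ge0.
have cG : cvg (gammaG (nu + n%:R) (x ^+ 2 / 4) @[x --> 0^'+]).
  apply: nonincreasing_at_right_is_cvgr; apply: nearW => b.
    move=> u v; rewrite !in_itv/= => /andP[u0 _] _ uv.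
    by apply: gammaG_le => //; exact: sq_le.
  by exists (gammaG (nu + n%:R) 0) => _ [u _ <-]; exact: gammaG_le.
have cf : cvg (f x @[x --> 0^'+]).
  by apply: is_cvgM; [exact: is_cvg_cst|exact: is_cvgM].
case/cvg_ex: cf => l fl; apply/cvg_ex; exists l.
apply: cvg_trans fl; apply: near_eq_cvg; near=> x.
by rewrite besselIK_posE.
Unshelve. all: by end_near. Qed.

End product.

Unset Implicit Arguments.

(** The first conjunct certifies that the [lim] defining [besselIK] at 0 is a genuine limit and not
    a default value. *)
Theorem theorem3p3 (R : realType) (nu : R) (n : nat)
    (hnu : - (1 / 2) < nu) (hn : (1 <= n)%N) :
  cvg (besselIK_pos nu n y @[y --> (0 : R)^'+]) /\
  forall x : R, 0 <= x ->
    `|besselIK nu n x| <= 2 ^+ (n - 1) / (2 * nu + 1).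
Proof.
have c := cvg_besselIK_pos hnu hn.
split=> // x; rewrite le_eqVlt => /predU1P[<-|x0]; rewrite /besselIK.
  (* At 0 both the sign and the upper bound pass to the limit from positive arguments. *)
  rewrite eqxx ger0_norm.
    apply: limr_le => //; near=> z.
    by apply: besselIK_pos_le.
  apply: limr_ge => //; near=> z.
  by apply: besselIK_pos_ge0.
rewrite gt_eqF// ger0_norm ?besselIK_pos_ge0//.
exact: besselIK_pos_le.
Unshelve. all: by end_near. Qed.
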